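(* Let $(A,[\cdot,\cdot],(\cdot)^{[p]})$ be a restricted Lie algebra over a field of characteristic $p>2$, endowed with a restricted Rota-Baxter operator $P$. Define an operation $\circ$ on $A$ by $x\circ y=[P(x),y]$. Then $(A,\circ)$ is a trivially restricted pre-Lie algebra, that is, it is a restricted pre-Lie algebra with $p$-map $x^{[p]'}=\operatorname{ad}_{Px}^{p-1}(x)$. Moreover, with $[x,y]_C=x\circ y-y\circ x$, $P$ is a morphism of restricted Lie algebras $$P:(A,[\cdot,\cdot]_C,(\cdot)^{[p]'})\to(A,[\cdot,\cdot],(\cdot)^{[p]}).$$
   Context: Restricted Lie algebra over a field $\mathbf{K}$ of characteristic $p>0$: a Lie algebra $L$ with a map $(\cdot)^{[p]}:L\to L$ (the $p$-map) such that $(\alpha x)^{[p]}=\alpha^p x^{[p]}$, $[x^{[p]},y]=(\operatorname{ad}_x)^p(y)$ and $(x+y)^{[p]}=x^{[p]}+y^{[p]}+\sum_{i=1}^{p-1}s_i(x,y)$, where $\operatorname{ad}_x(y)=[x,y]$ and $i\,s_i(x,y)$ is the coefficient of $\lambda^{i-1}$ in $(\operatorname{ad}_{\lambda x+y})^{p-1}(x)$. A morphism of restricted Lie algebras is a Lie algebra morphism $f$ with $f(x^{[p]})=f(x)^{[p]'}$ for all $x$. A Rota-Baxter operator (of weight $0$) on a Lie algebra $L$ is a linear map $P:L\to L$ with $[Px,Py]=P([Px,y]+[x,Py])$ for all $x,y$. On a restricted Lie algebra it is called restricted if $P(x)^{[p]}=P(\operatorname{ad}_{Px}^{p-1}(x))$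 for all $x$. A pre-Lie algebra is a vector space $A$ with a bilinear product $\circ$ such that $x\circ(y\circ z)-(x\circ y)\circ z=y\circ(x\circ z)-(y\circ x)\circ z$. Its commutator $[x,y]_C=x\circ y-y\circ x$ is a Lie bracket. In characteristic $p$, put $x^{\circ.p}=x\circ(x\circ(\cdots(x\circ x)))$ ($p$ factors $x$). The pre-Lie algebra is trivially restricted if $x^{\circ.p}\circ y=x\circ(x\circ(\cdots(x\circ y)))$ ($p$ copies of $x$ on the right-hand side) for all $x,y$. A restricted pre-Lie algebra is a pre-Lie algebra over a field of characteristic $p$ with a map $(\cdot)^{[p]}$ such that (i) $(\alpha x)^{[p]}=\alpha^px^{[p]}$; (ii) $x^{[p]}\circ y=x\circ(\cdots(x\circ y))$ ($p$ copies of $x$); (iii) $y\circ x^{[p]}=x\circ(\cdots(x\circ y))-[x,[x,\cdots[x,y]_C]_C]_C$ ($p$ copies of $x$ in each term); (iv) $(x+y)^{[p]}=x^{[p]}+y^{[p]}+\sum_{i=1}^{p-1}s_i(x,y)$, with $s_i$ computed in the commutator Lie algebra. The commutator Lie algebra of a restricted pre-Lie algebra is a restricted Lie algebra with the same $p$-map. *)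

(* Defs.v *)
From HB Require Import structures.
From mathcomp Require Import all_boot all_order all_algebra.

Set Implicit Arguments.
Unset Strict Implicit.
Unset Printing Implicit Defensive.

Import GRing.Theory.
Local Open Scope ring_scope.

Section RestrictedStructures.
Variables (K : fieldType) (A : lmodType K).
Implicit Types (op br : A -> A -> A) (pm : A -> A) (x y z : A).

Definition bilinear_op op : Prop := bilinear_for *:%R *:%R op.

Record is_lie_algebra br : Prop := IsLieAlgebra {
  lie_bilinear : bilinear_op br;
  lie_alternating : forall x, br x x = 0;
  lie_jacobi : forall x y z,
    br x (br y z) + br y (br z x) + br z (br x y) = 0
}.

(* An element of A[lambda] is given by its coefficients c : nat -> A, with     *)
(* c k the coefficient of lambda^k. The bracket of A extended                  *)
(* lambda-linearly to A[lambda] makes ad_(lambda x + y) send                   *)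
(* \sum_k lambda^k c_k to \sum_k lambda^k ([x, c_(k-1)] + [y, c_k]).           *)
Definition lam_const x : nat -> A := fun k => if k is 0 then x else 0.

Definition lam_ad br x y (c : nat -> A) : nat -> A :=
  fun k => (if k is j.+1 then br x (c j) else 0) + br y (c k).

(* The factor i of the defining relation "i s_i(x, y) = ..." is inverted in K, *)
(* which is legitimate for 1 <= i < p when K has characteristic p.             *)
Definition jacobson_s br (p i : nat) x y : A :=
  (i%:R : K)^-1 *: iter p.-1 (lam_ad br x y) (lam_const x) i.-1.

Record is_restricted_lie_algebra (p : nat) br pm : Prop :=
  IsRestrictedLieAlgebra {
  rlie_pchar : p \in [pchar K];
  rlie_lie : is_lie_algebra br;
  rlie_pmapZ : forall (a : K) x, pm (a *: x) = a ^+ p *: pm x;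
  rlie_pmap_ad : forall x y, br (pm x) y = iter p (br x) y;
  rlie_pmapD : forall x y,
    pm (x + y) = pm x + pm y + \sum_(1 <= i < p) jacobson_s br p i x y
}.

Definition is_rota_baxter br (P : {linear A -> A}) : Prop :=
  forall x y, br (P x) (P y) = P (br (P x) y + br x (P y)).

Definition is_restricted_rota_baxter (p : nat) br pm (P : {linear A -> A}) :
    Prop :=
  is_rota_baxter br P /\ (forall x, pm (P x) = P (iter p.-1 (br (P x)) x)).

Record is_pre_lie_algebra op : Prop := IsPreLieAlgebra {
  pre_lie_bilinear : bilinear_op op;
  pre_lie_axiom : forall x y z,
    op x (op y z) - op (op x y) z = op y (op x z) - op (op y x) z
}.

Definition commutator_of op : A -> A -> A := fun x y => op x y - op y x.

(* x o (x o ( ... (x o x))), with p factors x. *)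
Definition right_power op (p : nat) x : A := iter p.-1 (op x) x.

Record is_trivially_restricted_pre_lie (p : nat) op : Prop :=
  IsTriviallyRestrictedPreLie {
  trpl_pchar : p \in [pchar K];
  trpl_pre_lie : is_pre_lie_algebra op;
  trpl_power : forall x y, op (right_power op p x) y = iter p (op x) y
}.

Record is_restricted_pre_lie (p : nat) op pm : Prop := IsRestrictedPreLie {
  rpl_pchar : p \in [pchar K];
  rpl_pre_lie : is_pre_lie_algebra op;
  rpl_pmapZ : forall (a : K) x, pm (a *: x) = a ^+ p *: pm x;
  rpl_pmap_left : forall x y, op (pm x) y = iter p (op x) y;
  rpl_pmap_right : forall x y,
    op y (pm x) = iter p (op x) y - iter p (commutator_of op x) y;
  rpl_pmapD : forall x y,
    pm (x + y) = pm x + pm y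
      + \sum_(1 <= i < p) jacobson_s (commutator_of op) p i x y
}.

End RestrictedStructures.

Record is_restricted_lie_morphism (K : fieldType) (A B : lmodType K) (p : nat)
    (brA : A -> A -> A) (pmA : A -> A) (brB : B -> B -> B) (pmB : B -> B)
    (f : A -> B) : Prop := IsRestrictedLieMorphism {
  rmor_source : is_restricted_lie_algebra p brA pmA;
  rmor_target : is_restricted_lie_algebra p brB pmB;
  rmor_linear : linear f;
  rmor_bracket : forall x y, f (brA x y) = brB (f x) (f y);
  rmor_pmap : forall x, f (pmA x) = pmB (f x)
}.

(* Consistency of the encoding of A[lambda]: evaluating the coefficients of    *)
(* (ad_(lambda x + y))^n (x) at a scalar a gives (ad_(a x + y))^n (x).         *)
Lemma lam_ad_iter_eval (K : fieldType) (A : lmodType K) (br : A -> A -> A)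
    (br_bilin : bilinear_op br) (x y : A) (a : K) (n : nat) :
  \sum_(k < n.+1) a ^+ k *: iter n (lam_ad br x y) (lam_const x) k
    = iter n (br (a *: x + y)) x.
Proof.
have linl z : linear (br ^~ z) by exact: br_bilin.1.
have linr z : linear (br z) by exact: br_bilin.2.
have br0 u : br u 0 = 0.
  by have := linr u (-1) 0 0; rewrite scaler0 addr0 => ->; rewrite scaleN1r addNr.
have brD u v w : br u (v + w) = br u v + br u w.
  by have := linr u 1 v w; rewrite !scale1r.
have brZ u b v : br u (b *: v) = b *: br u v.
  by have := linr u b v 0; rewrite br0 !addr0.
have deg m k : (m < k)%N -> iter m (lam_ad br x y) (lam_const x) k = 0.
  elim: m k => [|m IHm] [|k] //= lt_mk.
  by rewrite /lam_ad IHm // IHm ?(ltnW lt_mk) // !br0 addr0.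
have br_sum u m (F : nat -> A) :
    br u (\sum_(k < m) F k) = \sum_(k < m) br u (F k).
  elim: m => [|m IHm]; first by rewrite !big_ord0 br0.
  by rewrite !big_ord_recr /= brD IHm.
elim: n => [|n IHn]; first by rewrite big_ord1 /= expr0 scale1r.
rewrite [RHS]iterS -IHn; set c := iter n _ _.
have -> v : br (a *: x + y) v = a *: br x v + br y v by exact: linl.
rewrite !(br_sum _ _ (fun k => a ^+ k *: c k)) /= -/c /lam_ad.
under eq_bigr do rewrite scalerDr.
rewrite big_split /= big_ord_recl /= scaler0 add0r; congr (_ + _).
  rewrite scaler_sumr; apply: eq_bigr => k _.
  by rewrite brZ scalerA -exprS.
rewrite big_ord_recr /= /c (deg n n.+1) // br0 scaler0 addr0.
by apply: eq_bigr => k _; rewrite brZ.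
Qed.

(* Main.v *)
(* In characteristic p, if operators satisfy T R_k = R_k C + R_(k+1) for all k,
   then T^p R_0 = R_0 C^p + R_p.

   In a pre-Lie algebra take T = L_x (left multiplication by x), C = ad_x, R_0
   the identity and R_k right multiplication by the k-th right power of x: this
   computes y o x^{o p} without further hypothesis.

   For a representation rho, take T = C = rho(lambda x + y) acting on M[lambda],
   R_0 = - d/dlambda and R_(k+1) = rho(ad_(lambda x + y)^k (x)). On constants
   d/dlambda vanishes, so d/dlambda T^p = rho(ad_(lambda x + y)^(p-1) (x)), which
   gives Jacobson's formula for rho(x + y)^p. Left multiplication in a pre-Lie
   algebra extends to a representation by affine maps sending the origin to x,
   whose p-th power sends it to x^{o p}; hence x^{o p} is additive up to the s_i.

   So a trivially restricted pre-Lie algebra is restricted with p-map x^{o p},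
   and the Rota-Baxter statement reduces to the trivial restrictedness of o. *)
Require Import Defs.
From HB Require Import structures.
From mathcomp Require Import all_boot all_order all_algebra.

Set Implicit Arguments.
Unset Strict Implicit.
Unset Printing Implicit Defensive.

Import GRing.Theory.
Local Open Scope ring_scope.

(** * Binomial expansion of an intertwining relation *)

Section Intertwining.
(** Families are compared pointwise; [I] will be [nat] for coefficient sequences and [unit] for
    single vectors. *)
Variables (V I : Type) (M : zmodType).
Variables (T : (I -> M) -> I -> M) (C : V -> V).
Hypothesis T_ext : forall u v, u =1 v -> T u =1 T v.
Hypothesis T_add : forall u v, T (u \+ v) =1 T u \+ T v.

Lemma iter_ext n u v : u =1 v -> iter n T u =1 iter n T v.
Proof. by move=> uv; elim: n => //= n IHn; apply: T_ext. Qed.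

Lemma iter_add n u v : iter n T (u \+ v) =1 iter n T u \+ iter n T v.
Proof.
elim: n => //= n IHn i.
by rewrite (T_ext IHn) T_add.
Qed.

(** Pascal's rule: the innermost [T] splits the expression, and the induction hypothesis applies to
    [R] and to its shift. *)
Lemma iter_intertwine (R : nat -> V -> I -> M) :
    (forall k v, T (R k v) =1 R k (C v) \+ R k.+1 v) ->
  forall n v i, iter n T (R 0 v) i
    = \sum_(k < n.+1) R k (iter (n - k) C v) i *+ 'C(n, k).
Proof.
move=> TR n; elim: n R TR => [|n IHn] R TR v i; first by rewrite big_ord1.
rewrite iterSr (iter_ext _ (TR _ _)) iter_add /= IHn //.
rewrite (IHn (fun k => R k.+1)) => [|k w]; last exact: TR.
rewrite [RHS]big_ord_recl bin0 mulr1n subn0.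
under [in RHS]eq_bigr do rewrite lift0 binS mulrnDr subSS.
rewrite big_split /= addrA; congr (_ + _).
rewrite big_ord_recl bin0 mulr1n subn0 -iterSr; congr (_ + _).
rewrite [RHS]big_ord_recr /= bin_small // mulr0n addr0.
by apply: eq_bigr => k _; rewrite /bump leq0n add1n -iterSr subnSK.
Qed.

Lemma iter_intertwine_prime (p : nat) (R : nat -> V -> I -> M) :
    prime p -> (forall u : M, u *+ p = 0) ->
    (forall k v, T (R k v) =1 R k (C v) \+ R k.+1 v) ->
  forall v i, iter p T (R 0 v) i = R 0 (iter p C v) i + R p v i.
Proof.
case: p => // p p_pr Mp TR v i.
rewrite iter_intertwine // big_ord_recl big_ord_recr bin0 subn0 mulr1n.
rewrite lift0 binn subnn mulr1n big1 => [|k _]; first by rewrite /= add0r.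
rewrite lift0; have /dvdnP[m ->] : (p.+1 %| 'C(p.+1, k.+1))%N.
  by rewrite prime_dvd_bin //= ltnS.
by rewrite mulnC mulrnA Mp mul0rn.
Qed.

End Intertwining.

(** * Coefficients of powers of a pencil of operators *)

Section Pencil.
Variable M : zmodType.
Implicit Types (X Y : {additive M -> M}) (s t : nat -> M) (v : M).

(* The action of lambda X + Y on M[lambda], encoded as in [lam_ad]. *)
Definition pencil (X Y : M -> M) s : nat -> M :=
  fun k => (if k is j.+1 then X (s j) else 0) + Y (s k).

Lemma pencil_ext (X Y : M -> M) :
  forall s t, s =1 t -> pencil X Y s =1 pencil X Y t.
Proof. by move=> s t st [|k]; rewrite /pencil !st. Qed.

Lemma pencil_add X Y :
  forall s t, pencil X Y (s \+ t) =1 pencil X Y s \+ pencil X Y t.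
Proof. by move=> s t [|k]; rewrite /pencil /= !raddfD ?add0r // addrACA. Qed.

Variables (X Y : {additive M -> M}) (v : M).

Definition const_seq : nat -> M := fun k => if k is 0 then v else 0.

Let c n := iter n (pencil X Y) const_seq.

Lemma pencil_iter_gt n k : (n < k)%N -> c n k = 0.
Proof.
elim: n k => [|n IHn] [|k] //= lt_nk.
by rewrite /c /= /pencil -/(c n) !IHn ?(ltnW lt_nk) // !raddf0 addr0.
Qed.

Lemma pencil_iter_bot n : c n 0%N = iter n Y v.
Proof. by elim: n => //= n <-; rewrite /c /= /pencil add0r. Qed.

Lemma pencil_iter_top n : c n n = iter n X v.
Proof.
elim: n => //= n <-.
by rewrite /c /= /pencil -/(c n) (pencil_iter_gt (ltnSn n)) raddf0 addr0.
Qed.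

(** Evaluation at lambda = 1 of a polynomial of degree at most [n]. *)
Lemma pencil_iter_sum n :
  \sum_(k < n.+1) c n k = iter n (fun u => X u + Y u) v.
Proof.
elim: n => [|n IHn]; first by rewrite big_ord1.
rewrite iterS -IHn !raddf_sum.
rewrite -/(c n.+1) /c iterS -/(c n) /pencil big_split /= big_ord_recl /= add0r.
by congr (_ + _); rewrite big_ord_recr /= pencil_iter_gt // raddf0 addr0.
Qed.

End Pencil.

(** * Jacobson's formula in a representation *)

Section Jacobson.
Variables (K : fieldType) (p : nat) (A M : lmodType K).
Variables (br : A -> A -> A) (rho : {bilinear A -> M -> M}).
Hypothesis pcharK : p \in [pchar K].
Hypothesis rho_br :
  forall x y v, rho (br x y) v = rho x (rho y v) - rho y (rho x v).

Lemma pchar_mulrn (u : M) : u *+ p = 0.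
Proof. by rewrite -scaler_nat pcharf0 // scale0r. Qed.

(* The action of A[lambda] on M[lambda]. *)
Definition conv (a : nat -> A) (s : nat -> M) : nat -> M :=
  fun k => \sum_(i < k.+1) rho (a i) (s (k - i)%N).

(** Leibniz rule: on M[lambda], rho(lambda x + y) commutes with rho(a) up to
    rho([lambda x + y, a]). *)
Lemma pencil_conv x y a s :
  pencil (rho x) (rho y) (conv a s)
    =1 conv a (pencil (rho x) (rho y) s) \+ conv (lam_ad br x y a) s.
Proof.
move=> k; rewrite [RHS]/=; have -> : conv (lam_ad br x y a) s k =
    (if k is j.+1 then
      \sum_(i < j.+1) (rho x (rho (a i) (s (j - i)%N))
                        - rho (a i) (rho x (s (j - i)%N)))
     else 0)
    + \sum_(i < k.+1) (rho y (rho (a i) (s (k - i)%N))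
                        - rho (a i) (rho y (s (k - i)%N))).
  rewrite /conv /lam_ad.
  under eq_bigr do rewrite linearDl /= rho_br.
  rewrite big_split /=; congr (_ + _).
  case: k => [|k]; first by rewrite big_ord1 linear0l.
  rewrite big_ord_recl linear0l add0r.
  by apply: eq_bigr => i _; rewrite lift0 subSS rho_br.
have -> : conv a (pencil (rho x) (rho y) s) k =
    (if k is j.+1 then \sum_(i < j.+1) rho (a i) (rho x (s (j - i)%N)) else 0)
    + \sum_(i < k.+1) rho (a i) (rho y (s (k - i)%N)).
  rewrite /conv /pencil.
  under eq_bigr do rewrite linearDr /=.
  rewrite big_split /=; congr (_ + _).
  case: k => [|k]; first by rewrite big_ord1 linear0r.
  rewrite big_ord_recr /= subnn linear0r addr0.
  by apply: eq_bigr => i _; rewrite subSn // -ltnS.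
rewrite /= addrACA -big_split /pencil /conv /= !linear_sumr.
congr (_ + _); last by apply: eq_bigr => i _; rewrite addrC subrK.
case: k => [|k]; first by rewrite addr0.
rewrite linear_sumr -big_split /=.
by apply: eq_bigr => i _; rewrite addrC subrK.
Qed.

Lemma pencil_iter_coef x y v k :
  iter p (pencil (rho x) (rho y)) (const_seq v) k.+1 *+ k.+1
    = rho (iter p.-1 (lam_ad br x y) (lam_const x) k) v.
Proof.
have p_pr := pcharf_prime pcharK.
set T := pencil _ _; set a := fun n => iter n (lam_ad br x y) (lam_const x).
(* [R 0] is minus the derivation d/dlambda, whose commutator with the pencil is
   the action of x. *)
pose R n s := if n is m.+1 then conv (a m) s else fun k => - (s k.+1 *+ k.+1).
have TR n s : T (R n s) =1 R n (T s) \+ R n.+1 s.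
  case: n => [|n]; last exact: pencil_conv.
  move=> j /=; rewrite /T /pencil /conv big_ord_recl big1 => [|i _]; last first.
    by rewrite linear0l.
  rewrite subn0 addr0 linearNr linearMnr mulrnDl opprD addrAC; congr (_ + _).
  case: j => [|j]; first by rewrite addNr.
  by rewrite linearNr linearMnr [in RHS]mulrSr opprD subrK.
have := iter_intertwine_prime (pencil_ext (rho x) (rho y))
  (pencil_add (rho x) (rho y)) p_pr pchar_mulrn TR (const_seq v) k.
(* A constant has derivative zero, so [T] is iterated on zero. *)
rewrite -/T; have -> : iter p T (R 0 (const_seq v)) k = 0.
  elim: (p) k => [|n IHn] k /=; first by rewrite mul0rn oppr0.
  rewrite {1}/T /pencil !IHn linear0r.
  by case: k => [|k]; rewrite ?IHn ?linear0r addr0.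
case: p p_pr => // q _ /eqP; rewrite eq_sym addrC subr_eq0 => /eqP <- /=.
rewrite /conv big_ord_recr /= subnn big1 ?add0r // => i _.
have: (0 < k - i)%N by rewrite subn_gt0.
by case: (k - i)%N => // j _; rewrite linear0r.
Qed.

(** The extreme coefficients of the p-th power of the pencil are the powers of rho y and rho x; for
    0 < i < p, i is invertible in [K] and the coefficient of lambda^i is the action of s_i. *)
Lemma jacobson_formula x y v :
  iter p (rho (x + y)) v = iter p (rho x) v + iter p (rho y) v
    + rho (\sum_(1 <= i < p) jacobson_s br p i x y) v.
Proof.
have p_gt0 := prime_gt0 (pcharf_prime pcharK).
transitivity (iter p (fun u => rho x u + rho y u) v).
  by apply: eq_iter => u; rewrite linearDl.
rewrite -pencil_iter_sum -(big_mkord xpredT (iter p _ (const_seq v))).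
rewrite big_nat_recr // big_ltn //= pencil_iter_bot pencil_iter_top.
rewrite addrC addrA; congr (_ + _); rewrite linear_sumlz.
apply: eq_big_nat => i /andP[i_gt0 i_ltp].
have iK : (i%:R : K) != 0.
  by rewrite -(dvdn_pcharf pcharK) gtnNdvd.
rewrite /jacobson_s linearZl_LR /=; case: i i_gt0 i_ltp iK => // i _ _ iK.
by rewrite -pencil_iter_coef -scaler_nat scalerA mulVf // scale1r.
Qed.

End Jacobson.

(** * Trivially restricted pre-Lie algebras *)

Section PreLie.
Variables (K : fieldType) (p : nat) (A : lmodType K).
Variable op : {bilinear A -> A -> A}.
Hypothesis pcharK : p \in [pchar K].
Hypothesis op_pre_lie : is_pre_lie_algebra op.

Lemma pre_lie_commutatorl x y z :
  op (commutator_of op x y) z = op x (op y z) - op y (op x z).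
Proof.
rewrite linearBl; have /eqP := pre_lie_axiom op_pre_lie x y z.
by rewrite subr_eq => /eqP ->; rewrite -addrA [RHS]addrC addrA subrK.
Qed.

Lemma right_power_right x y :
  op y (right_power op p x)
    = iter p (op x) y - iter p (commutator_of op x) y.
Proof.
pose T u (i : unit) := op x (u i).
pose R n (v : A) (_ : unit) := if n is m.+1 then op v (iter m (op x) x) else v.
have T_ext u v : u =1 v -> T u =1 T v by move=> uv i; rewrite /T uv.
have T_add u v : T (u \+ v) =1 T u \+ T v.
  by move=> i; rewrite /T /= linearDr.
have TR n v : T (R n v) =1 R n (commutator_of op x v) \+ R n.+1 v.
  case: n => [|n] i; rewrite /T /R /= ?subrK //.
  by rewrite pre_lie_commutatorl subrK.
have iterT n : iter n T (R 0 y) tt = iter n (op x) y.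
  by elim: n => //= n <-.
have := iter_intertwine_prime T_ext T_add (pcharf_prime pcharK)
  (pchar_mulrn pcharK) TR y tt.
rewrite iterT => ->; case: p (prime_gt0 (pcharf_prime pcharK)) => // q _.
by rewrite /R /= addrAC subrr add0r.
Qed.

(* The affine map v |-> x o v + x of A, linearized on A * K. *)
Definition affine_rep (x : A) (u : A * K^o) : A * K^o :=
  (op x u.1 + (u.2 : K) *: x, 0).

Lemma affine_rep_bilinear : bilinear_for *:%R *:%R affine_rep.
Proof.
split=> [u|x] a.
  move=> x y; congr (_, _); last by rewrite /= scaler0 addr0.
  by rewrite linearPl /= !scalerDr !scalerA mulrC addrACA.
move=> [u s] [v t]; congr (_, _); last by rewrite /= scaler0 addr0.
by rewrite linearPr /= scalerDr scalerDl scalerA addrACA.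
Qed.

HB.instance Definition _ :=
  bilinear_isBilinear.Build K A (A * K^o)%type (A * K^o)%type *:%R *:%R
    affine_rep affine_rep_bilinear.

(** The translation parts agree because the identity map is a 1-cocycle for left multiplication. *)
Lemma affine_rep_commutator x y u :
  affine_rep (commutator_of op x y) u
    = affine_rep x (affine_rep y u) - affine_rep y (affine_rep x u).
Proof.
congr (_, _); last by rewrite subrr.
rewrite /= !scale0r !addr0 !linearDr pre_lie_commutatorl scalerBr.
by rewrite !linearZr_LR opprD addrACA.
Qed.

Lemma iter_affine_rep x :
  iter p (affine_rep x) (0, 1) = (right_power op p x, 0).
Proof.
case: p (prime_gt0 (pcharf_prime pcharK)) => // q _; rewrite iterSr.
rewrite {2}/affine_rep /= linear0r add0r scale1r /right_power /=.
by elim: q => //= q ->; rewrite /affine_rep scale0r addr0.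
Qed.

Lemma right_powerD x y :
  right_power op p (x + y) = right_power op p x + right_power op p y
    + \sum_(1 <= i < p) jacobson_s (commutator_of op) p i x y.
Proof.
(* [affine_rep w (0, 1)] is (w, 0), so the sum of the s_i is read off directly. *)
have := jacobson_formula pcharK affine_rep_commutator x y (0, 1).
rewrite !iter_affine_rep => /(congr1 fst) /= ->.
by rewrite linear0r add0r scale1r.
Qed.

Lemma right_powerZ (a : K) x :
  right_power op p (a *: x) = a ^+ p *: right_power op p x.
Proof.
have iterZ n : iter n (op (a *: x)) (a *: x) = a ^+ n.+1 *: iter n (op x) x.
  elim: n => //= n ->.
  by rewrite linearZl_LR linearZr_LR scalerA /= -exprS.
by rewrite /right_power iterZ prednK // prime_gt0 // (pcharf_prime pcharK).
Qed.

Lemma trivially_restricted_is_restricted :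
    is_trivially_restricted_pre_lie p op ->
  is_restricted_pre_lie p op (right_power op p).
Proof.
case=> _ _ op_power; split=> //.
- exact: right_powerZ.
- exact: right_power_right.
- exact: right_powerD.
Qed.

Lemma restricted_pre_lie_commutator (pm : A -> A) :
    is_restricted_pre_lie p op pm ->
  is_restricted_lie_algebra p (commutator_of op) pm.
Proof.
case=> _ _ pmZ pm_left pm_right pmD; split=> //.
- split.
  + by split=> z a x y /=;
      rewrite /commutator_of linearPl linearPr /= scalerBr opprD addrACA.
  + by move=> x; rewrite /commutator_of subrr.
  + move=> x y z; rewrite {1 3 5}/commutator_of !pre_lie_commutatorl.
    rewrite !linearBr.
    (* Each double commutator becomes a difference whose subtrahend opens the next one, so the
       cyclic sum telescopes. *)
    have subrBB (a b c d : A) : a - b - (c - d) = a + d - (c + b).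
      by rewrite opprB addrACA -opprD [b + c]addrC.
    by rewrite !subrBB !subrKA subrr.
- by move=> x y; rewrite /commutator_of pm_left pm_right subKr.
Qed.

End PreLie.

Definition pack_bilinear (K : fieldType) (A : lmodType K) (op : A -> A -> A)
    (op_bilin : bilinear_op op) : {bilinear A -> A -> A} :=
  HB.pack op (bilinear_isBilinear.Build K A A A *:%R *:%R op op_bilin).

(** * Pre-Lie products from Rota-Baxter operators *)

Section RotaBaxter.
Variables (K : fieldType) (A : lmodType K) (br : {bilinear A -> A -> A}).
Hypothesis br_lie : is_lie_algebra br.

Lemma lie_antisym x y : br x y = - br y x.
Proof.
have /eqP := lie_alternating br_lie (x + y).
rewrite linearDl !linearDr /= !(lie_alternating br_lie) add0r addr0.
by rewrite addr_eq0 => /eqP.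
Qed.

Lemma lie_ad_bracket x y z : br (br x y) z = br x (br y z) - br y (br x z).
Proof.
rewrite lie_antisym [br x z]lie_antisym linearNr opprK; apply/eqP.
by rewrite eq_sym -addr_eq0 (lie_jacobi br_lie).
Qed.

Variable P : {linear A -> A}.
Hypothesis P_rb : is_rota_baxter br P.
Let circ x y := br (P x) y.

(** By antisymmetry, the argument of [P] in the Rota-Baxter identity is the commutator of [circ]. *)
Lemma rota_baxter_commutator x y : P (commutator_of circ x y) = br (P x) (P y).
Proof. by rewrite P_rb /commutator_of /circ [br x _]lie_antisym. Qed.

Lemma rota_baxter_bilinear : bilinear_op circ.
Proof.
split=> [z|z] a x y; rewrite /circ; last exact: linearPr.
by rewrite linearP; apply: linearPl.
Qed.

(** Left multiplication is ad composed with [P], hence a representation of the commutator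
    bracket. *)
Lemma rota_baxter_pre_lie : is_pre_lie_algebra circ.
Proof.
split=> [|x y z]; first exact: rota_baxter_bilinear.
have circ_comm : circ (circ x y) z - circ (circ y x) z
    = circ x (circ y z) - circ y (circ x z).
  by rewrite /circ -linearBl -linearB rota_baxter_commutator lie_ad_bracket.
apply/eqP; rewrite subr_eq -addrA [- _ + _]addrC circ_comm.
by rewrite addrC subrK.
Qed.

End RotaBaxter.

Theorem proposition3p17 (K : fieldType) (p : nat) (pcharK : p \in [pchar K])
    (p_gt2 : (2 < p)%N) (A : lmodType K) (br : A -> A -> A) (pm : A -> A)
    (A_rlie : is_restricted_lie_algebra p br pm)
    (P : {linear A -> A}) (P_rRB : is_restricted_rota_baxter p br pm P) :
  let circ := fun x y : A => br (P x) y in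
  let pm' := fun x : A => iter p.-1 (br (P x)) x in
  [/\ is_trivially_restricted_pre_lie p circ,
      forall x : A, pm' x = right_power circ p x,
      is_restricted_pre_lie p circ pm'
    & is_restricted_lie_morphism p (commutator_of circ) pm' br pm P].
Proof.
have br_lie := rlie_lie A_rlie.
have [brb brE] : exists brb : {bilinear A -> A -> A}, brb = br :> (A -> A -> A).
  by exists (pack_bilinear (lie_bilinear br_lie)).
case: _ / brE in br_lie A_rlie P_rRB *; have [P_rb P_pm] := P_rRB.
move=> circ pm'; have circ_pre_lie := rota_baxter_pre_lie br_lie P_rb.
pose op := pack_bilinear (rota_baxter_bilinear brb P).
have circ_triv : is_trivially_restricted_pre_lie p circ.
  (* Restrictedness of [P] sends the right power of x to the p-map of P x, whose ad is the p-th
     power of ad (P x). *)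
  by split=> // x y; rewrite /circ -P_pm (rlie_pmap_ad A_rlie).
have circ_rpl : is_restricted_pre_lie p circ pm'.
  exact: (@trivially_restricted_is_restricted K p A op).
split=> //; split=> //.
- exact: (@restricted_pre_lie_commutator K p A op).
- exact: linearP.
- exact: rota_baxter_commutator.
Qed.
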